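(* For every partition $\lambda$ and all integers $k,l\ge0$, $$\sum_{\alpha:\ \boldsymbol{\lambda}(\alpha)=\lambda}\mathcal{HQ}_\alpha(X;Y)=\sum_{\beta:\ \boldsymbol{\lambda}(\beta)=\lambda'}\mathcal{RHQ}_\beta(X;Y),$$ where $\lambda'$ is the conjugate partition, and $\boldsymbol{\lambda}(\alpha)$ denotes the partition obtained by sorting the parts of the composition $\alpha$ into weakly decreasing order.
   Context: Fix $k,l\ge0$, $\mathcal{A}=\{1,\dots,k\}$, $\mathcal{A}'=\{1',\dots,l'\}$ with total order $1<\dots<k<1'<\dots<l'$, $X=(x_1,\dots,x_k)$, $Y=(y_1,\dots,y_l)$. French notation: row $i$ is the $i$-th from the bottom; cell $(i,j)$ is in row $i$, column $j$. For a composition $\alpha=(\alpha_1,\dots,\alpha_r)$ with largest part $m$, its diagram has $\alpha_i$ cells in row $i$; for a filling $F$, $\hat F$ is the $r\times m$ array obtained by putting $\infty$ (larger than all letters, in neither alphabet) in the missing cells. A hook composition tableau (HCT) of shape $\alpha$ is a filling $F$ with letters of $\mathcal{A}\cup\mathcal{A}'$ such that: rows weakly increase left to right; unprimed entries weakly and primed entries strictly increase along rows; in the leftmost column unprimed entries strictly and primed entries weakly increase bottom to top; and for all $1\le i<j\le r$, $1\le n<m$: (a) if $\hat F(i,n+1)\in\mathcal{A}$ and $\hat F(i,n+1)\ge\hat F(j,n)$ then $\hat F(i,n+1)>\hat F(j,n+1)$; (b) if $\hat F(i,n+1)\in\mathcal{A}'$ and $\hat F(i,n+1)>\hat F(j,n)$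 then $\hat F(i,n+1)\ge \hat F(j,n+1)$. A row-strict hook composition tableau (RHCT) of shape $\alpha$ is a filling $F$ with letters of $\mathcal{A}\cup\mathcal{A}'$ such that: rows weakly increase left to right; unprimed entries strictly and primed entries weakly increase along rows; in the leftmost column unprimed entries weakly and primed entries strictly increase bottom to top; and for all $1\le i<j\le r$, $1\le n<m$: (a) if $\hat F(i,n+1)\in\mathcal{A}'$ and $\hat F(i,n+1)\ge\hat F(j,n)$ then $\hat F(i,n+1)>\hat F(j,n+1)$; (b) if $\hat F(i,n+1)\in\mathcal{A}$ and $\hat F(i,n+1)>\hat F(j,n)$ then $\hat F(i,n+1)\ge\hat F(j,n+1)$. $\mathcal{HQ}_\alpha(X;Y)$ (resp. $\mathcal{RHQ}_\alpha(X;Y)$) is the sum over all HCT (resp. RHCT) $F$ of shape $\alpha$ of $\prod_i x_i^{v_i}\prod_i y_i^{u_i}$, where $v_i$, $u_i$ are the numbers of entries $i$, $i'$ in $F$.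
   Formalization: The leftmost column is required to increase weakly as a whole in the order 1<...<k<1'<...<l' (unprimed below primed), besides the stated strictness; without this the identity fails, e.g. k=l=1, λ=(2): x²+xy versus x²+2xy. *)

(* Defs.v *)
From mathcomp Require Import all_boot all_order all_algebra.
From mathcomp.multinomials Require Import mpoly.

Set Implicit Arguments.
Unset Strict Implicit.
Unset Printing Implicit Defensive.

Import GRing.Theory.

(* Compositions are sequences of positive naturals and partitions are weakly  *)
(* decreasing compositions; the empty one is allowed.                         *)

Definition is_composition (alpha : seq nat) : bool := all (ltn 0) alpha.

Definition is_partition (la : seq nat) : bool :=
  is_composition la && sorted geq la.

Definition sort_parts (alpha : seq nat) : seq nat := sort geq alpha.

Definition conj_part (la : seq nat) : seq nat :=
  mkseq (fun j => count (fun p => j < p) la) (head 0 la).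

(* A composition of n.+1 is either 1 followed by a composition of n, or a     *)
(* nonempty composition of n whose first part has been incremented.           *)
Fixpoint compositions (n : nat) : seq (seq nat) :=
  if n is n'.+1 then
    flatten [seq (1 :: c) :: (if c is a :: s then [:: a.+1 :: s] else [::])
            | c <- compositions n']
  else [:: [::]].

Lemma mem_compositions (n : nat) (alpha : seq nat) :
  (alpha \in compositions n) = is_composition alpha && (sumn alpha == n).
Proof.
elim: n alpha => [|n IHn] alpha /=.
  by case: alpha => [|[|a] s] //=; rewrite inE /= andbF.
apply/flatten_mapP/andP => [[c] | [] ].
  rewrite IHn => /andP[comp_c /eqP sum_c].
  case: c comp_c sum_c => [|a s] /=; rewrite !inE.
    by move=> _ <- /eqP->.
  move=> /andP[a_gt0 s_gt0] <- /orP[]/eqP-> /=.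
    by rewrite a_gt0 s_gt0.
  by rewrite s_gt0 addSn.
case: alpha => [|[|[|a]] s] //= s_gt0.
  rewrite add1n eqSS => sum_s; exists s; first by rewrite IHn sum_s andbT.
  by rewrite inE eqxx.
rewrite addSn eqSS => sum_s.
exists (a.+1 :: s); first by rewrite IHn /= s_gt0 sum_s.
by rewrite !inE eqxx orbT.
Qed.

Lemma uniq_compositions (n : nat) : uniq (compositions n).
Proof.
elim: n => // n IHn; rewrite [compositions n.+1]/=.
pose f c := (1 :: c) :: (if c is a :: s then [:: a.+1 :: s] else [::]).
pose g d := if d is 1 :: s then s else if d is a.+1 :: s then a :: s else [::].
rewrite -[X in flatten X]/(map f (compositions n)).
have fK c d : is_composition c -> d \in f c -> g d = c.
  rewrite /f; case: c => [|[|a] s] //= _; first by rewrite inE => /eqP->.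
  by rewrite !inE => /orP[]/eqP->.
have: all is_composition (compositions n).
  by apply/allP=> c; rewrite mem_compositions => /andP[].
elim: (compositions n) IHn => // c cs IHcs /andP[c_cs u_cs] /andP[comp_c comp_cs].
have uf : uniq (f c) by case: c comp_c {c_cs} => [|[|a] s].
rewrite [map _ _]/= [flatten _]/= -cat_cons cat_uniq uf (IHcs u_cs comp_cs) andbT.
apply/hasPn => d /flatten_mapP[c' c'_cs fc'd]; apply/negP => fcd.
case/negP: c_cs; rewrite -(fK c d comp_c fcd) (fK c' d) //.
exact: (allP comp_cs).
Qed.

Section Tableaux.

Variables k l : nat.

(* inl i is the unprimed letter i.+1 and inr j is the primed letter (j.+1)'.  *)
Definition letter : finType := ('I_k + 'I_l)%type.

Definition unprimed (a : letter) : bool := if a is inl _ then true else false.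
Definition primed (a : letter) : bool := ~~ unprimed a.

(* Entries of the completed array: None stands for the symbol infinity.       *)
Definition entry := option letter.

(* Position of an entry in the chain 1 < ... < k < 1' < ... < l' < infinity.  *)
Definition rank (a : entry) : nat :=
  match a with
  | Some (inl i) => i
  | Some (inr j) => k + j
  | None => k + l
  end.

Definition ele (a b : entry) : bool := rank a <= rank b.
Definition elt (a b : entry) : bool := rank a < rank b.

Section Shape.

Variable alpha : seq nat.

Definition max_part : nat := \max_(a <- alpha) a.

(* Cells (row, column) of the diagram, both counted from 0; row 0 is the      *)
(* bottom row.                                                                *)
Definition cells : seq (nat * nat) :=
  [seq (i, j) | i <- iota 0 (size alpha), j <- iota 0 (nth 0 alpha i)].

Definition cell : finType := seq_sub cells.
Definition row_of (c : cell) : nat := (val c).1.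
Definition col_of (c : cell) : nat := (val c).2.

Definition filling := {ffun cell -> letter}.

Definition hat (F : filling) (i j : nat) : entry :=
  omap F (insub (i, j) : option cell).

(* HCTs and RHCTs only differ by exchanging the roles of the two alphabets.   *)
(* The predicate W selects the alphabet whose letters may repeat in a row but *)
(* not in the leftmost column; the letters of the other alphabet may repeat   *)
(* in the leftmost column but not in a row.                                   *)
Section Conditions.

Variables (W : pred letter) (F : filling).

Definition row_cond : bool :=
  [forall c : cell, forall d : cell,
    (row_of c == row_of d) && (col_of c < col_of d) ==>
    [&& ele (Some (F c)) (Some (F d))
      & ~~ W (F c) && ~~ W (F d) ==> elt (Some (F c)) (Some (F d))]].

Definition column_cond : bool :=
  [forall c : cell, forall d : cell,
    [&& col_of c == 0, col_of d == 0 & row_of c < row_of d] ==>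
    [&& ele (Some (F c)) (Some (F d))
      & W (F c) && W (F d) ==> elt (Some (F c)) (Some (F d))]].

Definition in_alphabet (V : pred letter) (a : entry) : bool :=
  if a is Some b then V b else false.

Definition triple_cond : bool :=
  [forall i : 'I_(size alpha), forall j : 'I_(size alpha),
   forall n : 'I_max_part, (i < j) && (n.+1 < max_part) ==>
    [&& in_alphabet W (hat F i n.+1) && ele (hat F j n) (hat F i n.+1)
          ==> elt (hat F j n.+1) (hat F i n.+1)
      & in_alphabet (predC W) (hat F i n.+1) && elt (hat F j n) (hat F i n.+1)
          ==> ele (hat F j n.+1) (hat F i n.+1)]].

Definition composition_tableau : bool :=
  [&& row_cond, column_cond & triple_cond].

End Conditions.

Definition is_HCT (F : filling) : bool := composition_tableau unprimed F.
Definition is_RHCT (F : filling) : bool := composition_tableau primed F.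

Local Open Scope ring_scope.

Definition xvar (i : 'I_k) : {mpoly int[k + l]} := 'X_(lshift l i).
Definition yvar (j : 'I_l) : {mpoly int[k + l]} := 'X_(rshift k j).

Definition weight (F : filling) : {mpoly int[k + l]} :=
  (\prod_(i < k) xvar i ^+ #|[set c | F c == inl i]|) *
  (\prod_(j < l) yvar j ^+ #|[set c | F c == inr j]|).

Definition HQ : {mpoly int[k + l]} := \sum_(F : filling | is_HCT F) weight F.
Definition RHQ : {mpoly int[k + l]} := \sum_(F : filling | is_RHCT F) weight F.

End Shape.

End Tableaux.

(* Main.v *)
(* Both sides are the generating function of the hook semistandard tableaux   *)
(* of shape la. Sorting each column of a composition tableau gives such a     *)
(* tableau. Conversely, given a column of a composition tableau and the       *)
(* multiset of entries of the next one, exactly one arrangement of these      *)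
(* entries satisfies the row and triple conditions, as soon as the two sorted *)
(* columns satisfy the row condition. This works for any alphabet in place of *)
(* the unprimed letters, hence also for the row-strict tableaux; transposing  *)
(* a semistandard tableau exchanges the two alphabets.                        *)

Require Import Defs.
From mathcomp Require Import all_boot all_order all_algebra.
From mathcomp Require Import perm zify.
From mathcomp.multinomials Require Import mpoly.

Set Implicit Arguments.
Unset Strict Implicit.
Unset Printing Implicit Defensive.

Import GRing.Theory.

(** Both sides equal the hook Schur function of $\lambda$: the sum over fillings of $\lambda$ in
    which letters of the alphabet [W] (the unprimed one) may repeat along rows but not down columns,
    and the other letters the reverse.

    Letters are replaced by their ranks, with $N=k+l$ for infinity, and a tableau becomes an array
    given by its columns. For any alphabet [W], the tableaux whose shape sorts to $\lambda$ are
    exactly the composition arrays with the column heights of $\lambda$ ([hat_array_composition],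
    [sum_tableaux]): the row lengths can be read off the array, so the sum over compositions
    disappears.

    The core is a statement about two consecutive columns. For a fixed column [p], sorting is a
    bijection from the columns that may follow [p] to the strict columns that fit to the right of
    the sorted [p]. It lands there by [rowwise_sort] and [follow_distinct], is injective by
    [follow_inj] and surjective by [follow_exists]. Induction along the columns makes [sort_columns]
    a weight-preserving bijection from composition arrays to Young arrays ([sum_composition_array]).

    In a Young array rows obey [W] and columns its complement, so transposition replaces $\lambda$
    by $\lambda'$ and swaps the alphabets ([sum_young_array_conj]). Undoing the sorting for the
    complementary alphabet yields the row-strict side. *)

Lemma nth_sorted_downset (T : Type) (leT : rel T) (P : pred T) (x0 : T) s i :
  transitive leT -> sorted leT s ->
  (forall x y, leT x y -> P y -> P x) ->
  i < size s -> P (nth x0 s i) = (i < count P s).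
Proof.
move=> leT_tr s_sorted downP.
elim: s i s_sorted => // x s IHs i /= xs_path lt_i.
have allx : all (leT x) s by rewrite (order_path_min leT_tr).
have [Px|nPx] := boolP (P x).
  case: i lt_i => [|i] lt_i; first by rewrite /= Px addnC addn1.
  by rewrite /= add1n ltnS IHs ?(path_sorted xs_path).
have -> : count P s = 0.
  apply/eqP; rewrite -leqn0 leqNgt -has_count; apply/negP.
  elim: s allx {IHs xs_path lt_i} => //= y s IHs /andP[xy /IHs nP].
  by case/orP=> [/(downP _ _ xy)|//]; rewrite (negPf nPx).
case: i lt_i => [|i] lt_i /=; first by rewrite (negPf nPx).
rewrite ltn0; apply/negP => Pn; case/negP: nPx.
apply: downP Pn; elim: s i allx lt_i {IHs xs_path} => // y s IHs [|i] /=.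
  by case/andP.
by case/andP=> _ /IHs; apply.
Qed.

(** The two sides differ by $(b-a)(y-x)>0$. *)
Lemma rearrange_ltn a b x y : a < b -> x < y -> a * y + b * x < a * x + b * y.
Proof.
move=> lt_ab lt_xy.
rewrite -(subnKC (ltnW lt_ab)) -(subnKC (ltnW lt_xy)) !mulnDl !mulnDr.
have : 0 < (b - a) * (y - x) by rewrite muln_gt0 !subn_gt0 lt_ab.
lia.
Qed.

(** * The order relations of the two alphabets on ranks *)

Section Steps.

Variable N : nat.
Implicit Types (V W : pred nat) (a b c : nat).

(* The value [N] plays the role of infinity. For [V] the alphabet whose       *)
(* letters may repeat, [step V a b] allows [b] right after [a].               *)
Definition step V a b : bool := (b == N) || (if V b then a <= b else a < b).

Lemma step_leq V a b : a <= N -> step V a b -> a <= b.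
Proof. by rewrite /step; case: (V b) => ?; lia. Qed.

Lemma step_trans V a b c : b <= N -> c <= N ->
  step V a b -> step V b c -> step V a c.
Proof. by rewrite /step; case: (V b); case: (V c) => ? ?; lia. Qed.

Lemma step_monol V a a' b : a' <= a -> step V a b -> step V a' b.
Proof. by rewrite /step; case: (V b) => ?; lia. Qed.

Lemma step_monor V a b b' : b <= b' <= N -> step V a b -> step V a b'.
Proof.
rewrite leq_eqVlt => /andP[/orP[/eqP->//|lt_b le_b']].
by rewrite /step; case: (V b); case: (V b'); lia.
Qed.

(** Reversing and negating a step exchanges the alphabets. This duality turns both clauses of the
    triple condition into a single negated step. *)
Lemma stepN W a b : a <= N -> b < N -> ~~ step W b a = step (predC W) a b.
Proof.
move=> le_a lt_b; rewrite /step /= (ltn_eqF lt_b) negb_or.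
have [->|ne_ab] := eqVneq a b.
  by rewrite (ltn_eqF lt_b); case: (W b); rewrite /= ?leqnn ?ltnn.
have -> : (if W a then b <= a else b < a) = (b < a).
  by case: (W a) => //; apply/idP/idP; lia.
have -> : (if ~~ W b then a <= b else a < b) = (a < b).
  by case: (W b) => //; apply/idP/idP; lia.
by apply/idP/idP; lia.
Qed.

End Steps.

(** * Consecutive columns and their sorting *)

Section Columns.

Variables (N r : nat) (W : pred nat).

Local Notation column := (r.-tuple 'I_N.+1).
Local Notation leo := (fun a b : 'I_N.+1 => a <= b).
Local Notation stepo V := (fun a b : 'I_N.+1 => step N V a b).

Implicit Types p q s : column.

Definition rowwise p q : bool :=
  [forall i, step N W (tnth p i) (tnth q i)].

Lemma rowwise_trans : transitive rowwise.
Proof.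
move=> p q s /forallP pq /forallP qs; apply/forallP => i.
by apply: step_trans (pq i) (qs i); rewrite -ltnS.
Qed.

(** If the entry of row [i] would also fit in the higher row [j], then row [j] must hold an entry
    preceding it, ties being allowed only outside [W] (see [stepN]). *)
Definition triples p q : bool :=
  [forall i : 'I_r, forall j : 'I_r,
    [&& i < j, tnth q i < N & step N W (tnth p j) (tnth q i)]
      ==> ~~ step N W (tnth q i) (tnth q j)].

Definition follow p q : bool := rowwise p q && triples p q.

Definition strict_column p : bool := pairwise (stepo (predC W)) p.

Lemma leo_trans : transitive leo. Proof. by move=> a b c; apply: leq_trans. Qed.
Lemma leo_total : total leo. Proof. by move=> a b; apply: leq_total. Qed.
Lemma leo_anti : antisymmetric leo.
Proof. by move=> a b /anti_leq /val_inj. Qed.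

Definition sort_column p : column := [tuple of sort leo p].

Lemma perm_sort_column p : perm_eq (sort_column p) p.
Proof. by rewrite /sort_column /= perm_sort. Qed.

Lemma sort_column_sorted p : sorted leo (sort_column p).
Proof. exact: sort_sorted leo_total _. Qed.

Lemma sorted_perm_column (p q : column) :
  sorted leo p -> sorted leo q -> perm_eq p q -> p = q.
Proof.
move=> sp sq pq; apply: val_inj.
exact: (sorted_eq leo_trans leo_anti sp sq pq).
Qed.

Lemma strict_column_sorted p : strict_column p -> sorted leo p.
Proof.
move=> sp; apply/(@pairwise_sorted _ leo)/(sub_pairwise _ sp) => a b.
by apply: step_leq; rewrite -ltnS.
Qed.

Lemma strict_columnP p :
  reflect (forall i j : 'I_r, i < j -> step N (predC W) (tnth p i) (tnth p j))
          (strict_column p).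
Proof.
apply: (iffP (pairwiseP ord0)) => [sp i j ij | sp i j].
  rewrite !(tnth_nth ord0); apply: sp => //; by rewrite inE size_tuple.
rewrite !inE !size_tuple => ir jr ij.
by have := sp (Ordinal ir) (Ordinal jr) ij; rewrite !(tnth_nth ord0).
Qed.

(* For a sorted column, this is what strictness adds; unlike strictness it is *)
(* invariant under permutation of the rows.                                   *)
Definition distinct_column p : Prop := forall i j : 'I_r,
  i != j -> tnth p i = tnth p j -> tnth p i < N -> ~~ W (tnth p i).

Lemma sorted_strict p : sorted leo p -> distinct_column p -> strict_column p.
Proof.
move=> sp dp; apply/strict_columnP => i j ij.
have le_ij : tnth p i <= tnth p j.
  rewrite !(tnth_nth ord0).
  apply: (sorted_leq_nth leo_trans _ ord0 sp) => //; rewrite ?inE ?size_tuple //.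
  exact: ltnW.
have [eN|neN] := eqVneq (tnth p j : nat) N; first by rewrite /step eN eqxx.
rewrite /step (negPf neN) /=; case: ifP => // /negbFE Wj.
rewrite ltn_neqAle le_ij andbT; apply/eqP => /val_inj e.
have lt_N : tnth p j < N by rewrite ltn_neqAle neN -ltnS ltn_ord.
by have := dp i j; rewrite e Wj neq_ltn ij => /(_ isT erefl lt_N).
Qed.

Lemma strict_distinct p : strict_column p -> distinct_column p.
Proof.
move/strict_columnP => sp.
have wlog_lt (i j : 'I_r) : i < j -> tnth p i = tnth p j -> tnth p i < N ->
    ~~ W (tnth p i).
  move=> /sp + eq_ij; rewrite -eq_ij /step /=.
  by case: (W _) => //; rewrite ltnn orbF => /eqP->; rewrite ltnn.
move=> i j; rewrite neq_ltn => /orP[lt_ij|lt_ji] e lt_N.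
  exact: wlog_lt e lt_N.
by rewrite e; apply: wlog_lt lt_ji _ _ => //; rewrite -e.
Qed.

Lemma perm_distinct p q : perm_eq p q -> distinct_column p -> distinct_column q.
Proof.
move=> pq dp i j ne_ij eq_ij lt_N.
have /tuple_permP[s eq_s] : perm_eq q p by rewrite perm_sym.
have qE x : tnth q x = tnth p (s x).
  by rewrite (tnth_nth ord0) eq_s -tnth_nth tnth_mktuple.
move: eq_ij lt_N; rewrite !qE; apply: dp.
by rewrite (inj_eq perm_inj).
Qed.

(** If rows [i < j] of [q] agree, row compatibility in row [j] is the premise of the triple
    condition, whose conclusion forbids a tie in [W]. *)
Lemma follow_distinct p q : follow p q -> distinct_column q.
Proof.
case/andP=> /forallP rpq /forallP tpq.
have wlog_lt (i j : 'I_r) : i < j -> tnth q i = tnth q j -> tnth q i < N ->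
    ~~ W (tnth q i).
  move=> ij e lt_N; have /forallP/(_ j)/implyP := tpq i.
  rewrite ij lt_N {1}e rpq => /(_ isT); rewrite -e /step leqnn.
  by apply: contra => ->; rewrite orbT.
move=> i j; rewrite neq_ltn => /orP[lt_ij|lt_ji] e lt_N.
  exact: wlog_lt e lt_N.
by rewrite e; apply: wlog_lt lt_ji _ _ => //; rewrite -e.
Qed.

(* Let [v] be the least value occupying different rows in [q] and [q'], say a *)
(* row [i] in [q] only and a row [i'] in [q'] only. If [i < i'], the triple   *)
(* condition for [q] puts an entry smaller than [v] in row [i'] of [q], hence *)
(* of [q'], a contradiction.                                                  *)
Lemma follow_inj p q q' : follow p q -> follow p q' -> perm_eq q q' -> q = q'.
Proof.
pose diff q q' v := [exists i, (tnth q i == v :> nat) && (tnth q' i != v :> nat)].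
have diff_sym (u u' : column) v : perm_eq u u' -> diff u u' v -> diff u' u v.
  move=> uu' /existsP[i /andP[ui u'i]]; apply: contraT => /existsPn nd.
  (* The value [v] occurs equally often in both columns; if every row holding it in [u'] also held
     it in [u], row [i] would make this inclusion proper. *)
  have : #|[set j | tnth u' j == v :> nat]| = #|[set j | tnth u j == v :> nat]|.
    have cE (t : column) : #|[set j | tnth t j == v :> nat]|
        = count (fun a : 'I_N.+1 => a == v :> nat) t.
      rewrite cardsE cardE size_filter -[in RHS](map_tnth_enum t) count_map enumT.
      exact: eq_count.
    by rewrite !cE; apply/esym/seq.permP.
  move=> card_eq; have : [set j | tnth u' j == v :> nat] \proper
      [set j | tnth u j == v :> nat].
    apply/properP; split; last by exists i; rewrite inE.
    apply/subsetP=> j; rewrite !inE => u'j.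
    by have := nd j; rewrite u'j /= negbK.
  by move/proper_card; rewrite card_eq ltnn.
have main (u u' : column) v (i i' : 'I_r) : follow p u -> follow p u' ->
    (forall w, w < v -> ~~ diff u u' w) ->
    tnth u i = v :> nat -> tnth u' i != v :> nat -> 
    tnth u' i' = v :> nat -> tnth u i' != v :> nat -> v < N -> i < i' -> False.
  case/andP=> /forallP rpu /forallP tpu /andP[/forallP rpu' _].
  move=> minv ui u'i u'i' ui' lt_v lt_ii'.
  have /forallP/(_ i')/implyP := tpu i.
  rewrite lt_ii' ui lt_v -u'i' rpu' u'i' => /(_ isT) nst.
  have lt_u : tnth u i' < v.
    move: nst; rewrite /step negb_or; case: (W _); lia.
  have /existsPn/(_ i') := minv _ lt_u.
  by rewrite eqxx negbK u'i' => /eqP e; rewrite -e ltnn in lt_u.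
move=> fq fq' qq'; apply/eq_from_tnth => i0; apply: val_inj; apply/eqP.
apply: contraT => ne0.
have exd : exists v, diff q q' v.
  exists (tnth q i0); apply/existsP; exists i0; rewrite eqxx /=.
  by rewrite eq_sym.
case: (ex_minnP exd) => v dv minv.
have minv' w : w < v -> ~~ diff q q' w.
  by rewrite ltnNge; apply: contra => /minv.
have dv' := diff_sym _ _ _ qq' dv.
have minv'' w : w < v -> ~~ diff q' q w.
  by move/minv'; apply: contra; apply: diff_sym; rewrite perm_sym.
case/existsP: (dv) => i /andP[/eqP qi q'i].
case/existsP: dv' => i' /andP[/eqP q'i' qi'].
have lt_v : v < N.
  (* If [v] were infinity, the entry of [q'] in row [i] would be a smaller value placed differently,
     against minimality. *)
  have lt_q' : tnth q' i < v \/ v < N by move: q'i (ltn_ord (tnth q' i)); lia.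
  case: lt_q' => // lt_q'; have /existsPn/(_ i) := minv'' _ lt_q'.
  by rewrite eqxx negbK /= qi => /eqP e; rewrite -e ltnn in lt_q'.
have [lt_ii'|lt_i'i|/val_inj e] := ltngtP i i'.
- by case: (main q q' v i i').
- by case: (main q' q v i' i).
- by rewrite -e qi eqxx in qi'.
Qed.

(** Let [b] be the entry of index [t] in the sorted [q]. More than [t] entries of [q] are at most
    [b], and their left neighbours in [p] may all precede [b]. The values that may precede [b] form
    a down-set, so the entry of index [t] in the sorted [p] is one of them. *)
Lemma rowwise_sort p q : rowwise p q -> rowwise (sort_column p) (sort_column q).
Proof.
move=> /forallP rpq; apply/forallP => t.
set b := tnth (sort_column q) t.
have cE (P : pred 'I_N.+1) (u : column) : count P u = count (fun i => P (tnth u i)) (enum 'I_r).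
  by rewrite -{1}(map_tnth_enum u) count_map.
rewrite (tnth_nth ord0).
rewrite (@nth_sorted_downset _ leo (fun a => step N W a b)) ?size_tuple //; first last.
- by move=> x y; apply: step_monol.
- exact: sort_column_sorted.
- exact: leo_trans.
have : t < count (fun a : 'I_N.+1 => a <= b) (sort_column q).
  rewrite -(@nth_sorted_downset _ leo _ ord0) ?size_tuple //; first by rewrite -tnth_nth.
  - exact: leo_trans.
  - exact: sort_column_sorted.
  - by move=> x y; apply: leq_trans.
rewrite (seq.permP (perm_sort_column _)) (seq.permP (perm_sort_column p)) !cE => /leq_trans; apply.
apply: sub_count => i /= le_b; apply: step_monor (rpq i).
by rewrite le_b /=; exact: (ltn_ord b).
Qed.

(* Among the rearrangements compatible with [p], the one minimising           *)
(* [\sum_i i * q_i] satisfies the triple condition: exchanging the entries of *)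
(* a violating pair of rows keeps compatibility and lowers the sum.           *)
Lemma follow_exists p s : rowwise (sort_column p) (sort_column s) ->
  distinct_column s -> exists2 q : column, perm_eq q s & follow p q.
Proof.
move=> rps ds.
have [q0 q0s rq0] : exists2 q : column, perm_eq q s & rowwise p q.
  have /tuple_permP[f eq_f] : perm_eq p (sort_column p).
    by rewrite perm_sym perm_sort_column.
  (* Carry the sorted matching back to [p] along the permutation that sorts [p]. *)
  exists [tuple tnth (sort_column s) (f i) | i < r].
    apply: perm_trans (perm_sort_column s); apply/tuple_permP; by exists f.
  apply/forallP => i; rewrite tnth_mktuple.
  have -> : tnth p i = tnth (sort_column p) (f i).
    by rewrite (tnth_nth ord0) eq_f -tnth_nth tnth_mktuple.
  exact: (forallP rps).
pose pot (q : column) := \sum_(i < r) i * tnth q i.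
have [q /andP[qs rq] min_q] :=
  @arg_minnP _ q0 (fun q : column => perm_eq q s && rowwise p q) pot (introT andP (conj q0s rq0)).
exists q => //; rewrite /follow rq /=; apply/forallP => i; apply/forallP => j.
apply/implyP=> /and3P[lt_ij lt_N pj_qi]; apply/negP => qi_qj.
have ne_ij : i != j by rewrite neq_ltn lt_ij.
(* A tie would be a finite letter outside [W], which cannot step to itself. *)
have lt_q : tnth q i < tnth q j.
  have dq : distinct_column q by apply: perm_distinct ds; rewrite perm_sym.
  have := step_leq (ltn_ord (tnth q i) : _ <= N) qi_qj.
  rewrite leq_eqVlt => /orP[/eqP/val_inj e|//].
  have := qi_qj; rewrite /step -e (negPf (dq i j ne_ij e lt_N)) ltnn orbF.
  by move/eqP=> e'; rewrite e' ltnn in lt_N.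
pose q' : column := [tuple tnth q (tperm i j x) | x < r].
have q's : perm_eq q' s.
  by apply: perm_trans qs; apply/tuple_permP; exists (tperm i j).
have rq' : rowwise p q'.
  (* Row [i] receives [q_j], reached through [q_i]; row [j] receives [q_i], which fits there by the
     violated condition. *)
  apply/forallP=> x; rewrite tnth_mktuple; case: tpermP => [->|->|_ _] //.
    apply: step_trans (qi_qj); [by rewrite -ltnS | by rewrite -ltnS |].
    exact: (forallP rq).
  exact: (forallP rq).
have := min_q q'; rewrite q's rq' => /(_ isT).
rewrite /pot (bigD1 i) //= (bigD1 j) //= 1?eq_sym //.
rewrite [X in _ <= X](bigD1 i) //= [X in _ <= _ + X](bigD1 j) //= 1?eq_sym //.
rewrite !tnth_mktuple tpermL tpermR.
rewrite [X in _ <= _ + (_ + X)](eq_bigr (fun x : 'I_r => x * tnth q x)); last first.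
  move=> x /andP[xi xj]; rewrite tnth_mktuple tpermD // eq_sym //.
by rewrite !addnA leq_add2r leqNgt rearrange_ltn.
Qed.

End Columns.

(** * Partitions and conjugation *)

Section Partitions.

Implicit Types la : seq nat.

Lemma geq_trans : transitive geq.
Proof. by move=> a b c ab bc; apply: leq_trans bc ab. Qed.

Lemma ltn_nth_partition la n i : is_partition la -> i < size la ->
  (n < nth 0 la i) = (i < count (ltn n) la).
Proof.
case/andP=> _ s_la lt_i.
rewrite -(nth_sorted_downset 0 geq_trans s_la) //= => x y /= xy /leq_trans; exact.
Qed.

Lemma nth_leq_head la i : is_partition la -> nth 0 la i <= head 0 la.
Proof.
case: la => [|a s /andP[_ /= s_la]]; first by rewrite nth_nil.
case: (ltnP i (size (a :: s))) => [lt_i|ge_i]; last by rewrite nth_default.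
case: i lt_i => [|i] lt_i //=.
have /allP := order_path_min geq_trans s_la; apply.
by rewrite mem_nth.
Qed.

Lemma nth_conj_part la n : n < head 0 la ->
  nth 0 (conj_part la) n = count (ltn n) la.
Proof. exact: nth_mkseq. Qed.

Lemma size_conj_part la : size (conj_part la) = head 0 la.
Proof. exact: size_mkseq. Qed.

Lemma head_conj_part la : is_partition la -> head 0 (conj_part la) = size la.
Proof.
case: la => // a s /andP[pos _].
have a_gt0 : 0 < a by case/andP: pos.
rewrite -nth0 nth_conj_part //.
by move: pos; rewrite /is_composition all_count => /eqP.
Qed.

Lemma conj_part_partition la : is_partition la -> is_partition (conj_part la).
Proof.
move=> p_la; apply/andP; split.
  apply/allP => x /(nthP 0)[n]; rewrite size_conj_part => lt_n <-.
  rewrite /= nth_conj_part // -ltn_nth_partition ?nth0 //.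
  by case: la lt_n {p_la}.
apply/(sortedP 0) => n; rewrite size_conj_part => lt_n.
rewrite !nth_conj_part // ?(ltnW lt_n) //.
by apply: sub_count => x; apply: ltnW.
Qed.

Lemma ltn_nth_conj_part la n i : is_partition la -> i < size la -> n < head 0 la ->
  (i < nth 0 (conj_part la) n) = (n < nth 0 la i).
Proof. by move=> p_la lt_i lt_n; rewrite nth_conj_part // -ltn_nth_partition. Qed.

End Partitions.

(** * Composition arrays, Young arrays and transposition *)

Section Arrays.

Variable N : nat.
Implicit Types (W : pred nat) (la : seq nat).

Local Notation array m r := (m.-tuple (r.-tuple 'I_N.+1)).

Definition finite_count (c : seq 'I_N.+1) : nat := count (fun a : 'I_N.+1 => a < N) c.

Definition has_heights la m r (H : array m r) : bool :=
  [forall n : 'I_m, finite_count (tnth H n) == count (ltn n) la].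

(** Only the first column must be strict. The default column of infinities is used when there are no
    columns. *)
Definition composition_array W la m r (H : array m r) : bool :=
  [&& strict_column W (head [tuple of nseq r ord_max] H), sorted (follow W) H
    & has_heights la H].

Definition young_array W la m r (H : array m r) : bool :=
  [&& all (@strict_column N r W) H, sorted (rowwise W) H & has_heights la H].

Definition sort_columns m r (H : array m r) : array m r :=
  [tuple of map (@sort_column N r) H].

Lemma path_follow_sort W r (p : r.-tuple 'I_N.+1) cs : path (follow W) p cs ->
  path (rowwise W) (sort_column p) (map (@sort_column N r) cs) &&
  all (@strict_column N r W) (map (@sort_column N r) cs).
Proof.
elim: cs p => //= q cs IHcs p /andP[pq /IHcs /andP[-> ->]].
rewrite !andbT rowwise_sort; last by case/andP: pq.
apply: sorted_strict; first exact: sort_column_sorted.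
by apply: perm_distinct (follow_distinct pq); rewrite perm_sym perm_sort_column.
Qed.

Lemma path_follow_inj W r (p : r.-tuple 'I_N.+1) cs cs' :
  path (follow W) p cs -> path (follow W) p cs' ->
  map (@sort_column N r) cs = map (@sort_column N r) cs' -> cs = cs'.
Proof.
elim: cs p cs' => [|q cs IHcs] p [|q' cs'] //= /andP[pq pcs] /andP[pq' pcs'].
case=> eq_q eq_cs.
have {pq'} eq_q : q = q'.
  apply: follow_inj pq pq' _.
  rewrite -(permPl (perm_sort_column q)) -(permPr (perm_sort_column q')) /=.
  by rewrite eq_q.
by rewrite -eq_q in pcs' *; rewrite (IHcs q cs').
Qed.

Lemma path_follow_exists W r (p : r.-tuple 'I_N.+1) cs :
  path (rowwise W) (sort_column p) cs -> all (@strict_column N r W) (cs) ->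
  exists2 qs, path (follow W) p qs & map (@sort_column N r) qs = cs.
Proof.
elim: cs p => [|s cs IHcs] p /=; first by exists [::].
case/andP=> ps scs /andP[st_s st_cs].
have sortK (q : r.-tuple 'I_N.+1) : perm_eq q s -> sort_column q = s.
  move=> qs; apply: sorted_perm_column; first exact: sort_column_sorted.
    exact: strict_column_sorted st_s.
  by rewrite (permPl (perm_sort_column q)).
have [|q qs pq] := @follow_exists N r W p s _ (strict_distinct st_s).
  by rewrite (sortK s).
have [|qs' q_qs' eq_qs'] := IHcs q _ st_cs; first by rewrite sortK.
by exists (q :: qs'); rewrite /= ?pq // sortK // eq_qs'.
Qed.

Lemma sort_columns_heights la m r (H : array m r) :
  has_heights la (sort_columns H) = has_heights la H.
Proof.
apply: eq_forallb => n; rewrite tnth_map /finite_count.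
by rewrite (seq.permP (perm_sort_column _)).
Qed.

Lemma sort_strict_column W r (p : r.-tuple 'I_N.+1) :
  strict_column W p -> sort_column p = p.
Proof.
move=> sp; apply: sorted_perm_column; first exact: sort_column_sorted.
  exact: strict_column_sorted sp.
exact: perm_sort_column.
Qed.

Lemma sort_columns_young W la m r (H : array m r) :
  composition_array W la H -> young_array W la (sort_columns H).
Proof.
rewrite /young_array sort_columns_heights => /and3P[st fo ->].
rewrite andbT /=; case: H => [[|p cs] size_H] //= in st fo *.
by have /andP[-> ->] := path_follow_sort fo; rewrite (sort_strict_column st) st.
Qed.

(** The first column is strict, hence fixed by sorting; [follow_inj] then recovers each column from
    the previous one. *)
Lemma sort_columns_inj W la m r :
  {in @composition_array W la m r &, injective (@sort_columns m r)}.
Proof.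
move=> H H' /and3P[st fo _] /and3P[st' fo' _] /(congr1 val) /= eqs; apply: val_inj.
case: H => [[|p cs] size_H] /= in st fo eqs *; case: H' => [[|p' cs'] size_H'] //= in st' fo' eqs *.
case: eqs => eq_p eq_cs.
have {}eq_p : p = p'.
  by rewrite -(sort_strict_column st) -(sort_strict_column st'); apply: val_inj.
by rewrite -eq_p in fo' *; rewrite (path_follow_inj fo fo').
Qed.

Lemma sort_columns_surj W la m r (S : array m r) : young_array W la S ->
  exists2 H, composition_array W la H & sort_columns H = S.
Proof.
case/and3P=> st ro hei.
suff [H [st_H fo_H eq_S]] : exists H : array m r,
    [/\ strict_column W (head [tuple of nseq r ord_max] H), sorted (follow W) H
       & sort_columns H = S].
  by exists H => //; rewrite /composition_array st_H fo_H -sort_columns_heights eq_S.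
case: S => [[|s cs] size_S] /= in st ro {hei} *.
  exists (Tuple size_S); split=> //=; last by apply: val_inj.
  apply/strict_columnP => i j _; rewrite !tnth_nseq /step.
  by rewrite eqxx.
case/andP: st => st_s st_cs.
have [|qs fo_qs eq_qs] := @path_follow_exists W r s cs _ st_cs.
  by rewrite (sort_strict_column st_s).
have size_H : size (s :: qs) == m by rewrite -(eqP size_S) -eq_qs /= size_map.
exists (Tuple size_H); split=> //; apply: val_inj => /=.
by rewrite (sort_strict_column st_s) eq_qs.
Qed.

(** This form treats rows and columns alike and states the shape cell by cell, so that transposition
    can be read off it. *)
Lemma young_arrayP W la m r (H : array m r) :
  is_partition la -> size la = r ->
  reflect [/\ forall n (i j : 'I_r), i < j ->
                step N (predC W) (tnth (tnth H n) i) (tnth (tnth H n) j),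
              forall (n n' : 'I_m) i, n < n' ->
                step N W (tnth (tnth H n) i) (tnth (tnth H n') i)
            & forall n i, (tnth (tnth H n) i < N) = (n < nth 0 la i)]
          (young_array W la H).
Proof.
move=> p_la size_la; pose c0 := [tuple of nseq r (@ord_max N)].
have sorted_count n (i : 'I_r) : sorted (fun a b : 'I_N.+1 => a <= b) (tnth H n) ->
    (tnth (tnth H n) i < N) = (i < finite_count (tnth H n)).
  move=> so; rewrite (tnth_nth ord0).
  rewrite (@nth_sorted_downset _ _ (fun a : 'I_N.+1 => a < N) _ _ _ (@leo_trans N) so) //.
    by move=> x y; apply: leq_ltn_trans.
  by rewrite size_tuple.
apply: (iffP and3P) => [[/allP st ro /forallP hei] | [st ro fin]].
  split=> [n||n i]; first by apply/strict_columnP/st/mem_tnth.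
    move=> n n' i lt_n; move: ro; rewrite sorted_pairwise; last exact: rowwise_trans.
    move/(pairwiseP c0).
    move/(_ n n'); rewrite !inE size_tuple => /(_ (ltn_ord _) (ltn_ord _) lt_n).
    by move/forallP/(_ i); rewrite -!tnth_nth.
  rewrite sorted_count ?(eqP (hei n)) ?ltn_nth_partition ?size_la //.
  exact/(@strict_column_sorted N r W)/st/mem_tnth.
have st' n : strict_column W (tnth H n) by apply/strict_columnP => i j; apply: st.
split; first by apply/allP => c /tnthP[n ->].
  rewrite sorted_pairwise; last exact: rowwise_trans.
  apply/(pairwiseP c0) => n n'.
  rewrite !inE size_tuple => lt_n lt_n' lt_nn'; apply/forallP => i.
  by have := ro (Ordinal lt_n) (Ordinal lt_n') i lt_nn'; rewrite !(tnth_nth c0).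
apply/forallP => n.
have le_r : finite_count (tnth H n) <= r.
  by rewrite -[X in _ <= X](size_tuple (tnth H n)) count_size.
have le_r' : count (ltn n) la <= r by rewrite -size_la count_size.
(* Both counts are at most [r], so they agree once they exceed the same indices below [r]. *)
have eq_lt i : i < r -> (i < finite_count (tnth H n)) = (i < count (ltn n) la).
  move=> lt_i; rewrite -(sorted_count n (Ordinal lt_i)).
    by rewrite fin /= ltn_nth_partition ?size_la.
  exact: strict_column_sorted (st' n).
rewrite eqn_leq; apply/andP; split; rewrite leqNgt; apply/negP => lt_c.
  by have := eq_lt _ (leq_trans lt_c le_r); rewrite lt_c ltnn.
by have := eq_lt _ (leq_trans lt_c le_r'); rewrite lt_c ltnn.
Qed.

Definition transpose m r (H : array m r) : array r m :=
  [tuple [tuple tnth (tnth H n) i | n < m] | i < r].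

Lemma tnth_transpose m r (H : array m r) i n :
  tnth (tnth (transpose H) i) n = tnth (tnth H n) i.
Proof. by rewrite !tnth_mktuple. Qed.

Lemma transposeK m r : cancel (@transpose m r) (@transpose r m).
Proof.
by move=> H; do 2!apply/eq_from_tnth => ?; rewrite !tnth_transpose.
Qed.

Lemma step_predCK W a b : step N (predC (predC W)) a b = step N W a b.
Proof. by rewrite /step /= negbK. Qed.

Lemma transpose_young W la m r (H : array m r) :
  is_partition la -> size la = r -> head 0 la = m ->
  young_array (predC W) (conj_part la) (transpose H) = young_array W la H.
Proof.
move=> p_la size_la head_la.
apply/young_arrayP/young_arrayP => //;
  rewrite ?conj_part_partition ?size_conj_part // => -[st ro fin]; split.
- by move=> n i j lt_ij; have := ro i j n lt_ij; rewrite !tnth_transpose.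
- by move=> n n' i lt_n; have := st i n n' lt_n; rewrite !tnth_transpose step_predCK.
- move=> n i; have := fin i n; rewrite tnth_transpose => ->.
  by rewrite ltn_nth_conj_part ?size_la ?head_la.
- by move=> i n n' lt_n; rewrite !tnth_transpose step_predCK; apply: ro.
- by move=> i j n lt_ij; rewrite !tnth_transpose; apply: st.
- by move=> i n; rewrite tnth_transpose fin ltn_nth_conj_part ?size_la ?head_la.
Qed.

Section Weight.

Variables (R : comNzRingType) (z : 'I_N.+1 -> R).
Local Open Scope ring_scope.

Definition array_weight m r (H : array m r) : R := \prod_(c <- H) \prod_(a <- c) z a.

Lemma array_weightE m r (H : array m r) :
  array_weight H = \prod_(n < m) \prod_(i < r) z (tnth (tnth H n) i).
Proof. by rewrite /array_weight big_tuple; apply: eq_bigr => n _; rewrite big_tuple. Qed.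

Lemma sort_columns_weight m r (H : array m r) :
  array_weight (sort_columns H) = array_weight H.
Proof.
rewrite /array_weight /= big_map; apply: eq_bigr => c _.
exact/perm_big/perm_sort_column.
Qed.

Lemma transpose_weight m r (H : array m r) :
  array_weight (transpose H) = array_weight H.
Proof.
rewrite !array_weightE exchange_big; apply: eq_bigr => n _; apply: eq_bigr => i _.
by rewrite tnth_transpose.
Qed.

Lemma sum_composition_array W la m r :
  \sum_(H : array m r | composition_array W la H) array_weight H =
  \sum_(H : array m r | young_array W la H) array_weight H.
Proof.
pose A := [set H : array m r | composition_array W la H].
transitivity (\sum_(S in @sort_columns m r @: A) array_weight S).
  rewrite big_imset /=; last first.
    by move=> H H'; rewrite !inE; apply: sort_columns_inj.
  by apply: eq_big => H; rewrite ?inE // sort_columns_weight.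
apply: eq_bigl => S; apply/imsetP/idP => [[H]|/sort_columns_surj[H H_A <-]].
  by rewrite inE => /sort_columns_young + ->.
by exists H; rewrite ?inE.
Qed.

Lemma sum_young_array_conj W la m r :
  is_partition la -> size la = r -> head 0 la = m ->
  \sum_(H : array m r | young_array W la H) array_weight H =
  \sum_(H : array r m | young_array (predC W) (conj_part la) H) array_weight H.
Proof.
move=> p_la size_la head_la; rewrite [RHS](reindex (@transpose m r)) /=; last first.
  by exists (@transpose r m) => H _; apply: transposeK.
by apply: eq_big => H; rewrite ?transpose_young // transpose_weight.
Qed.

End Weight.

End Arrays.

Lemma eq_partition s t : sorted geq s -> sorted geq t -> size s = size t ->
  (forall n, count (ltn n) s = count (ltn n) t) -> s = t.
Proof.
move=> so_s so_t eq_size eq_count; apply: (@eq_from_nth _ 0) => // i lt_i.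
have eq_lt n : (n < nth 0 s i) = (n < nth 0 t i).
  have down x y : geq x y -> ltn n y -> ltn n x by move=> /= xy /leq_trans; apply.
  have /= -> := nth_sorted_downset 0 geq_trans so_s down lt_i.
  rewrite eq_size in lt_i.
  by have /= -> := nth_sorted_downset 0 geq_trans so_t down lt_i; rewrite eq_count.
apply/eqP; rewrite eqn_leq; apply/andP; split; rewrite leqNgt; apply/negP => lt_n.
  by have := eq_lt (nth 0 t i); rewrite lt_n ltnn.
by have := eq_lt (nth 0 s i); rewrite lt_n ltnn.
Qed.

(** * The composition shape of an array *)

Section Shapes.

Variable N : nat.
Local Notation array m r := (m.-tuple (r.-tuple 'I_N.+1)).

Definition array_shape m r (H : array m r) : seq nat :=
  [seq finite_count [seq tnth c i | c : r.-tuple 'I_N.+1 <- H] | i <- enum 'I_r].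

Lemma nth_array_shape m r (H : array m r) (i : 'I_r) :
  nth 0 (array_shape H) i = finite_count [seq tnth c i | c : r.-tuple 'I_N.+1 <- H].
Proof. by rewrite (nth_map i) ?size_enum_ord // nth_ord_enum. Qed.

Lemma size_array_shape m r (H : array m r) : size (array_shape H) = r.
Proof. by rewrite size_map size_enum_ord. Qed.

Lemma array_shape_unique alpha m r (H : array m r) :
  size alpha = r -> (forall i, nth 0 alpha i <= m) ->
  (forall n i, (tnth (tnth H n) i < N) = (n < nth 0 alpha i)) ->
  array_shape H = alpha.
Proof.
move=> size_alpha le_m fin.
apply: (@eq_from_nth _ 0) => [|i]; rewrite size_array_shape // => lt_i.
rewrite (nth_array_shape H (Ordinal lt_i)) /finite_count.
rewrite count_map -[X in count _ X](map_tnth_enum H) count_map.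
rewrite (@eq_count _ _ (preim val (fun n => n < nth 0 alpha i))); last first.
  by move=> n /=; rewrite fin.
by rewrite -count_map val_enum_ord -size_filter (@filter_iota_ltn 0) ?size_iota.
Qed.

Variable W : pred nat.

Lemma composition_array_row la m r (H : array m r) (n n' : 'I_m) i :
  composition_array W la H -> n < n' ->
  step N W (tnth (tnth H n) i) (tnth (tnth H n') i).
Proof.
move=> /and3P[_ fo _] lt_n; pose c0 := [tuple of nseq r (@ord_max N)].
have ro : sorted (rowwise W) H by apply: sub_sorted fo => p q /andP[].
move: ro; rewrite sorted_pairwise; last exact: rowwise_trans.
move/(pairwiseP c0)/(_ n n'); rewrite !inE size_tuple => /(_ (ltn_ord _) (ltn_ord _) lt_n).
by move/forallP/(_ i); rewrite -!tnth_nth.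
Qed.

(** Rows weakly increase, so their finite entries form an initial segment. *)
Lemma ltn_array_shape la m r (H : array m r) (n : 'I_m) (i : 'I_r) :
  composition_array W la H ->
  (tnth (tnth H n) i < N) = (n < nth 0 (array_shape H) i).
Proof.
move=> H_A; rewrite nth_array_shape /finite_count.
set s := [seq _ | _ <- _]; pose c0 := [tuple of nseq r (@ord_max N)].
have nth_s (n' : 'I_m) : nth ord0 s n' = tnth (tnth H n') i.
  by rewrite (nth_map c0) ?size_tuple // -tnth_nth.
rewrite -nth_s (@nth_sorted_downset _ _ (fun a : 'I_N.+1 => a < N) _ _ _ (@leo_trans N)) //.
- apply/(@pairwise_sorted)/(pairwiseP ord0) => n1 n2.
  rewrite !inE size_map size_tuple => lt_n1 lt_n2 lt_n.
  rewrite (nth_s (Ordinal lt_n1)) (nth_s (Ordinal lt_n2)).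
  have lt_n' : Ordinal lt_n1 < Ordinal lt_n2 by [].
  by apply: (step_leq _ (composition_array_row i H_A lt_n')); rewrite -ltnS.
- by move=> x y; apply: leq_ltn_trans.
- by rewrite size_map size_tuple.
Qed.

Lemma count_array_shape la m r (H : array m r) n : is_partition la ->
  size la = r -> head 0 la = m -> composition_array W la H ->
  count (ltn n) (array_shape H) = count (ltn n) la.
Proof.
move=> p_la size_la head_la H_A; case: (ltnP n m) => [lt_n|ge_n].
  have /and3P[_ _ /forallP/(_ (Ordinal lt_n))/eqP <-] := H_A.
  rewrite /finite_count -[X in _ = count _ X](map_tnth_enum (tnth H _)) !count_map.
  apply: eq_in_count => i _ /=.
  by rewrite (ltn_array_shape _ _ H_A) nth_array_shape.
(* Beyond the last column both counts vanish, since no row is longer than [m]. *)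
have zero (s : seq nat) : (forall i, nth 0 s i <= m) -> count (ltn n) s = 0.
  move=> le_s; apply/eqP; rewrite -leqn0 leqNgt -has_count; apply/hasPn => x.
  by move/(nthP 0)=> [i _ <-]; rewrite /= -leqNgt (leq_trans (le_s i)).
rewrite !zero // => i; first by rewrite -head_la nth_leq_head.
case: (ltnP i r) => [lt_i|ge_i]; last by rewrite nth_default ?size_array_shape.
rewrite (nth_array_shape H (Ordinal lt_i)).
by apply: leq_trans (count_size _ _) _; rewrite size_map size_tuple.
Qed.

Lemma array_shape_composition la m r (H : array m r) : is_partition la ->
  size la = r -> head 0 la = m -> composition_array W la H ->
  is_composition (array_shape H).
Proof.
move=> p_la size_la head_la H_A; rewrite /is_composition all_count.
rewrite (count_array_shape 0 p_la size_la head_la H_A) size_array_shape -size_la.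
by rewrite -all_count; case/andP: p_la.
Qed.

Lemma sort_array_shape la m r (H : array m r) : is_partition la ->
  size la = r -> head 0 la = m -> composition_array W la H ->
  sort_parts (array_shape H) = la.
Proof.
move=> p_la size_la head_la H_A; apply: eq_partition.
- by apply: sort_sorted => x y; apply: leq_total.
- by case/andP: p_la.
- by rewrite size_sort size_array_shape.
by move=> n; rewrite -(count_array_shape n p_la size_la head_la H_A) count_sort.
Qed.

End Shapes.

(** * Fillings as arrays of ranks *)

Section Fillings.

Variables k l : nat.
Local Notation N := (k + l).

Lemma rank_ltn (a : letter k l) : rank (Some a) < N.
Proof. by case: a => [i|j] /=; rewrite ?ltn_add2l // ltn_addr. Qed.

Lemma rank_leq (e : entry k l) : rank e < N.+1.
Proof. by case: e => [a|] //; apply: ltnW (rank_ltn a). Qed.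

Lemma rank_inj : injective (@rank k l).
Proof.
case=> [a|] [b|] //; first last.
- by move=> e; have := rank_ltn b; rewrite -e ltnn.
- by move=> e; have := rank_ltn a; rewrite e ltnn.
case: a b => [i|j] [i'|j'] /=.
- by move/val_inj->.
- by move=> e; have := ltn_ord i; rewrite e ltnNge leq_addr.
- by move=> e; have := ltn_ord i'; rewrite -e ltnNge leq_addr.
- by move/addnI/val_inj->.
Qed.

Lemma rank_surj (x : nat) : x < N -> exists a : letter k l, rank (Some a) = x.
Proof.
move=> lt_x; case: (ltnP x k) => [lt_k|ge_k]; first by exists (inl (Ordinal lt_k)).
have lt_l : x - k < l by rewrite ltn_subLR.
by exists (inr (Ordinal lt_l)); rewrite /= subnKC.
Qed.

Definition rank_ord (e : entry k l) : 'I_N.+1 := Ordinal (rank_leq e).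

Section Shape.

Variable alpha : seq nat.

Lemma mem_cells i n : ((i, n) \in cells alpha) = (n < nth 0 alpha i).
Proof.
apply/allpairsPdep/idP => [[i' [n' [_ + [-> ->]]]]|lt_n]; first by rewrite mem_iota.
exists i, n; rewrite !mem_iota lt_n; split=> //=.
by rewrite ltnNge; apply: contraL lt_n => ge_i; rewrite nth_default.
Qed.

Lemma cell_col_ltn (c : cell alpha) : col_of c < nth 0 alpha (row_of c).
Proof. by rewrite -mem_cells -surjective_pairing (valP c). Qed.

Lemma cell_row_ltn (c : cell alpha) : row_of c < size alpha.
Proof. by rewrite ltnNge; apply: contraL (cell_col_ltn c) => ge_i; rewrite nth_default. Qed.

Variable F : filling k l alpha.

Lemma hat_cell (c : cell alpha) : hat F (row_of c) (col_of c) = Some (F c).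
Proof. by rewrite /hat /row_of /col_of -surjective_pairing valK. Qed.

Lemma hatP i n : n < nth 0 alpha i ->
  exists2 c : cell alpha, (row_of c = i /\ col_of c = n) & hat F i n = Some (F c).
Proof.
rewrite -mem_cells => in_c; exists (SeqSub in_c) => //.
exact: (hat_cell (SeqSub in_c)).
Qed.

Lemma hat_rank_ltn i n : (rank (hat F i n) < N) = (n < nth 0 alpha i).
Proof.
case: (boolP (n < _)) => [/hatP[c _ ->]|]; first exact: rank_ltn.
by rewrite -mem_cells => nc; rewrite /hat insubN //= ltnn.
Qed.

Definition hat_array m r : m.-tuple (r.-tuple 'I_N.+1) :=
  [tuple [tuple rank_ord (hat F i n) | i < r] | n < m].

Lemma tnth_hat_array m r n i :
  tnth (tnth (hat_array m r) n) i = rank_ord (hat F i n).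
Proof. by rewrite !tnth_mktuple. Qed.

End Shape.

Lemma hat_array_inj alpha m r (F F' : filling k l alpha) :
  size alpha = r -> (forall i, nth 0 alpha i <= m) ->
  hat_array F m r = hat_array F' m r -> F = F'.
Proof.
move=> size_alpha le_m eq_F; apply/ffunP => c.
have lt_c := cell_col_ltn c; have lt_i := cell_row_ltn c; rewrite size_alpha in lt_i.
have := congr1 (fun H => tnth (tnth H (Ordinal (leq_trans lt_c (le_m _)))) (Ordinal lt_i)) eq_F.
rewrite !tnth_hat_array /= => /(congr1 val) /= /rank_inj.
by rewrite !hat_cell => -[].
Qed.

Lemma hat_array_surj m r (H : m.-tuple (r.-tuple 'I_N.+1)) alpha :
  size alpha = r -> (forall i, nth 0 alpha i <= m) ->
  (forall n i, (tnth (tnth H n) i < N) = (n < nth 0 alpha i)) ->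
  exists F : filling k l alpha, hat_array F m r = H.
Proof.
move=> size_alpha le_m fin.
have [f fP] : exists f : cell alpha -> letter k l, forall c (n : 'I_m) (i : 'I_r),
    row_of c = i -> col_of c = n -> rank (Some (f c)) = tnth (tnth H n) i.
  pose P (c : cell alpha) (a : letter k l) := forall (n : 'I_m) (i : 'I_r),
    row_of c = i -> col_of c = n -> rank (Some a) = tnth (tnth H n) i.
  suff /fin_all_exists[f fP] : forall c, exists a, P c a by exists f.
  move=> c.
  have lt_c := cell_col_ltn c; have lt_i := cell_row_ltn c; rewrite size_alpha in lt_i.
  have lt_n := leq_trans lt_c (le_m _).
  have [|a ra] := @rank_surj (tnth (tnth H (Ordinal lt_n)) (Ordinal lt_i)).
    by rewrite fin.
  exists a => n i ei en; rewrite ra.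
  by congr (nat_of_ord (tnth (tnth H _) _)); apply: val_inj.
exists [ffun c => f c]; apply/eq_from_tnth => n; apply/eq_from_tnth => i.
rewrite tnth_hat_array; apply: val_inj => /=.
have [/(hatP [ffun c => f c])[c [ci cn] ->]|ge_n] := ltnP n (nth 0 alpha i).
  by rewrite ffunE; apply: fP.
have -> : rank (hat [ffun c => f c] i n) = N.
  apply/eqP; rewrite eqn_leq -ltnS rank_leq leqNgt.
  by rewrite hat_rank_ltn -leqNgt.
by apply/eqP; rewrite eq_sym eqn_leq -ltnS ltn_ord leqNgt fin -leqNgt.
Qed.

End Fillings.

Lemma nth_perm_partition alpha la i : is_partition la -> perm_eq alpha la ->
  nth 0 alpha i <= head 0 la.
Proof.
move=> p_la perm_alpha; have [lt_i|ge_i] := ltnP i (size alpha); last by rewrite nth_default.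
have : nth 0 alpha i \in la by rewrite -(perm_mem perm_alpha) mem_nth.
by case/(nthP 0) => j _ <-; apply: nth_leq_head.
Qed.

Lemma max_part_perm alpha la : is_partition la -> perm_eq alpha la ->
  max_part alpha = head 0 la.
Proof.
move=> p_la perm_alpha; rewrite /max_part (perm_big _ perm_alpha) /=.
apply/eqP; rewrite eqn_leq; apply/andP; split.
  by apply/bigmax_leqP_seq => _ /(nthP 0)[i _ <-] _; apply: nth_leq_head.
by case: la {p_la perm_alpha} => //= a s; rewrite big_cons leq_maxl.
Qed.

(** * Tableau conditions as array conditions *)

Section Tableaux.

Variables (k l : nat) (V : pred (letter k l)) (W : pred nat).
Hypothesis VW : forall a, V a = W (rank (Some a)).
Local Notation N := (k + l).

(** The two formulations can differ only at a tie, where both letters lie in the same alphabet. *)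
Lemma step_row_letter (a b : letter k l) :
  ele (Some a) (Some b) && (~~ V a && ~~ V b ==> elt (Some a) (Some b)) =
  step N W (rank (Some a)) (rank (Some b)).
Proof.
rewrite /ele /elt /step !VW (ltn_eqF (rank_ltn b)) /=.
move: (rank (Some a)) (rank (Some b)) => x y.
by case: ltngtP => [||->]; case: (W _); case: (W _).
Qed.

Lemma step_column_letter (a b : letter k l) :
  ele (Some a) (Some b) && (V a && V b ==> elt (Some a) (Some b)) =
  step N (predC W) (rank (Some a)) (rank (Some b)).
Proof.
rewrite /ele /elt /step !VW (ltn_eqF (rank_ltn b)) /=.
move: (rank (Some a)) (rank (Some b)) => x y.
by case: ltngtP => [||->]; case: (W _); case: (W _).
Qed.

Lemma triple_entry (e f g : entry k l) :
  (in_alphabet V e && ele f e ==> elt g e) &&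
  (in_alphabet (predC V) e && elt f e ==> ele g e) =
  ((rank e < N) && step N W (rank f) (rank e) ==> ~~ step N W (rank e) (rank g)).
Proof.
case: e => [a|]; last by rewrite /= ltnn.
rewrite stepN ?rank_ltn //; last by rewrite -ltnS rank_leq.
have -> : in_alphabet V (Some a) = W (rank (Some a)) by apply: VW.
have -> : in_alphabet (predC V) (Some a) = ~~ W (rank (Some a)) by rewrite -VW.
rewrite /ele /elt /step (ltn_eqF (rank_ltn a)) /predC.
move: (rank (Some a)) => x /=.
by case: (W _); rewrite /= ?andbT.
Qed.

Lemma hat_array_composition la alpha m r (F : filling k l alpha) :
  is_partition la -> is_composition alpha -> size la = r ->
  head 0 la = m -> sort_parts alpha = la ->
  composition_tableau V F = composition_array W la (hat_array F m r).
Proof.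
move=> p_la c_alpha size_la head_la sort_alpha.
have perm_alpha : perm_eq alpha la by rewrite -sort_alpha perm_sym perm_sort.
have size_alpha : size alpha = r by rewrite (perm_size perm_alpha).
have max_alpha : max_part alpha = m by rewrite (max_part_perm p_la perm_alpha).
have le_m i : nth 0 alpha i <= m by rewrite -head_la nth_perm_partition.
have lt_row (c : cell alpha) : row_of c < r /\ col_of c < m.
  by rewrite -size_alpha cell_row_ltn; split=> //; apply: leq_trans (cell_col_ltn c) (le_m _).
have hei : has_heights la (hat_array F m r).
  apply/forallP => n; rewrite -(seq.permP perm_alpha) /finite_count.
  rewrite -[X in count _ X == _](map_tnth_enum (tnth _ n)) count_map.
  rewrite (@eq_count _ _ (preim val (fun i => n < nth 0 alpha i))); last first.
    by move=> i /=; rewrite tnth_hat_array hat_rank_ltn.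
  rewrite -count_map val_enum_ord -size_alpha.
  by rewrite -(count_map (nth 0 alpha) (ltn n)) map_nth_iota0 // take_size.
pose c0 := [tuple of nseq r (@ord_max N)].
have tnth_hat n (i : 'I_r) : n < m ->
    tnth (nth c0 (hat_array F m r) n) i = rank (hat F i n) :> nat.
  by move=> lt_n; rewrite -(tnth_nth c0 _ (Ordinal lt_n)) tnth_hat_array.
have size_H : size (hat_array F m r) = m by rewrite size_tuple.
apply/and3P/and3P => [[/forallP row /forallP col /forallP tri]|[col fo _]].
  split=> //.
    apply/strict_columnP => i j lt_ij; rewrite -nth0 -/c0.
    have [m0|m_gt0] := posnP m.
      (* With no columns, the first column is the default one, made of infinities. *)
      by rewrite nth_default ?size_H ?m0 // !tnth_nseq /step eqxx.
    rewrite !tnth_hat //.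
    have pos (i' : 'I_r) : 0 < nth 0 alpha i'.
      by apply: (allP c_alpha); rewrite mem_nth // size_alpha.
    have [c [rc cc] ->] := hatP F (pos i); have [d [rd cd] ->] := hatP F (pos j).
    have /forallP/(_ d) := col c; rewrite rc rd cc cd lt_ij !eqxx /=.
    by rewrite -step_column_letter.
  apply/(sortedP c0) => n; rewrite size_H => lt_n; apply/andP; split.
    apply/forallP => i; rewrite !tnth_hat ?(ltnW lt_n) //.
    (* Past the end of the row the entry is infinity, and any step to it is allowed. *)
    have [lt_n1|ge_n1] := ltnP n.+1 (nth 0 alpha i); last first.
      rewrite /step (_ : rank (hat F i n.+1) = N) ?eqxx //.
      by apply/eqP; rewrite eqn_leq -ltnS rank_leq leqNgt hat_rank_ltn -leqNgt.
    have [c [rc cc] ->] := hatP F (ltnW lt_n1); have [d [rd cd] ->] := hatP F lt_n1.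
    have /forallP/(_ d) := row c; rewrite rc rd cc cd ltnSn !eqxx /=.
    by rewrite -step_row_letter.
  apply/forallP => i; apply/forallP => j; rewrite !tnth_hat ?(ltnW lt_n) //.
  apply/implyP => /andP[lt_ij]; apply: implyP; rewrite -triple_entry.
  have lt_i : i < size alpha by rewrite size_alpha.
  have lt_j : j < size alpha by rewrite size_alpha.
  have lt_n' : n < max_part alpha by rewrite max_alpha (ltnW lt_n).
  have /forallP/(_ (Ordinal lt_j))/forallP/(_ (Ordinal lt_n')) := tri (Ordinal lt_i).
  by rewrite /= lt_ij max_alpha lt_n.
split.
- apply/forallP => c; apply/forallP => d; apply/implyP => /andP[/eqP e_cd lt_cd].
  rewrite step_row_letter -!hat_cell e_cd.
  have [lt_r lt_c] := lt_row c; have [_ lt_d] := lt_row d; rewrite e_cd in lt_r.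
  (* [follow] relates adjacent columns only; transitivity, through [composition_array_row], reaches
     arbitrary pairs of cells in a row. *)
  have H_A : composition_array W la (hat_array F m r) by apply/and3P.
  have lt_cd' : Ordinal lt_c < Ordinal lt_d by [].
  have := composition_array_row (Ordinal lt_r) H_A lt_cd'.
  by rewrite !tnth_hat_array.
- apply/forallP => c; apply/forallP => d; apply/implyP => /and3P[/eqP cc /eqP cd lt_cd].
  rewrite step_column_letter -!hat_cell cc cd.
  have [lt_c c_lt_m] := lt_row c; have [lt_d _] := lt_row d; rewrite cc in c_lt_m.
  have /strict_columnP/(_ (Ordinal lt_c) (Ordinal lt_d) lt_cd) := col.
  by rewrite -nth0 -/c0 !tnth_hat.
apply/forallP => i; apply/forallP => j; apply/forallP => n.
apply/implyP => /andP[lt_ij lt_n']; rewrite triple_entry.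
have lt_n : n.+1 < m by rewrite -max_alpha.
have lt_i : i < r by rewrite -size_alpha.
have lt_j : j < r by rewrite -size_alpha.
have /(sortedP c0)/(_ n) := fo; rewrite size_H => /(_ lt_n)/andP[_].
move/forallP/(_ (Ordinal lt_i))/forallP/(_ (Ordinal lt_j)).
by rewrite !tnth_hat ?(ltnW lt_n) //= lt_ij.
Qed.

End Tableaux.

(** * Weights and generating functions *)

Section GeneratingFunctions.

Variables (k l : nat).
Local Notation N := (k + l).
Local Open Scope ring_scope.

(** Infinity has weight 1, so padding a filling to an array preserves its weight. *)
Definition rank_var (a : 'I_N.+1) : {mpoly int[N]} :=
  if insub (a : nat) is Some i then 'X_i else 1.

Lemma rank_var_letter (a : letter k l) :
  rank_var (rank_ord (Some a)) =
  match a with inl i => xvar l i | inr j => yvar k j end.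
Proof.
rewrite /rank_var insubT; first exact: rank_ltn.
by move=> lt_N; case: a lt_N => [i|j] lt_N; congr 'X_ _; apply: val_inj.
Qed.

Lemma weight_prod_cells alpha (F : filling k l alpha) :
  weight F = \prod_c rank_var (rank_ord (Some (F c))).
Proof.
rewrite (partition_big F xpredT) //= big_sumType /weight; congr (_ * _).
  apply: eq_bigr => i _; rewrite (eq_bigr (fun=> xvar l i)) => [|c /eqP->].
    by rewrite prodr_const; congr (_ ^+ _); apply: eq_card => c; rewrite inE.
  exact: (rank_var_letter (inl i)).
apply: eq_bigr => j _; rewrite (eq_bigr (fun=> yvar k j)) => [|c /eqP->].
  by rewrite prodr_const; congr (_ ^+ _); apply: eq_card => c; rewrite inE.
exact: (rank_var_letter (inr j)).
Qed.

Lemma weight_hat_array alpha m r (F : filling k l alpha) :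
  size alpha = r -> (forall i, nth 0 alpha i <= m)%N ->
  array_weight rank_var (hat_array F m r) = weight F.
Proof.
move=> size_alpha le_m; rewrite array_weightE weight_prod_cells.
rewrite pair_big /=; under eq_bigr do rewrite tnth_hat_array.
rewrite (bigID (fun p : 'I_m * 'I_r => p.1 < nth 0 alpha p.2)%N) /= [X in _ * X]big1 ?mulr1.
  have lt_r (c : cell alpha) : (row_of c < r)%N by rewrite -size_alpha cell_row_ltn.
  have lt_m (c : cell alpha) : (col_of c < m)%N := leq_trans (cell_col_ltn c) (le_m _).
  rewrite (reindex_omap (fun c => (Ordinal (lt_m c), Ordinal (lt_r c)))
     (fun p : 'I_m * 'I_r => insub (p.2 : nat, p.1 : nat) : option (cell alpha))) /=.
    apply: eq_big => c; last by rewrite hat_cell.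
    rewrite cell_col_ltn /= /row_of /col_of -surjective_pairing valK.
    exact: eqxx.
  case=> n i /= lt_n; rewrite insubT ?mem_cells //= => in_c.
  by congr (Some (_, _)); apply: val_inj.
case=> n i /= ge_n.
rewrite /rank_var insubN // -leqNgt leqNgt /=.
by rewrite hat_rank_ltn.
Qed.

Variables (V : pred (letter k l)) (W : pred nat).
Hypothesis VW : forall a, V a = W (rank (Some a)).

Variables (la : seq nat) (m r : nat).
Hypotheses (p_la : is_partition la) (size_la : size la = r) (head_la : head 0%N la = m).

Local Notation array := (m.-tuple (r.-tuple 'I_N.+1)).

Lemma sum_tableaux_shape alpha : is_composition alpha -> sort_parts alpha = la ->
  \sum_(F : filling k l alpha | composition_tableau V F) weight F =
  \sum_(H : array | composition_array W la H && (array_shape H == alpha))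
     array_weight rank_var H.
Proof.
move=> c_alpha sort_alpha.
have perm_alpha : perm_eq alpha la by rewrite -sort_alpha perm_sym perm_sort.
have size_alpha : size alpha = r by rewrite (perm_size perm_alpha).
have le_m i : (nth 0 alpha i <= m)%N by rewrite -head_la nth_perm_partition.
pose A := [set F : filling k l alpha | composition_tableau V F].
transitivity (\sum_(H in (fun F => hat_array F m r) @: A) array_weight rank_var H).
  rewrite big_imset /=; last first.
    by move=> F F' _ _; apply: hat_array_inj.
  by apply: eq_big => F; rewrite ?inE // weight_hat_array.
apply: eq_bigl => H; apply/imsetP/andP => [[F]|[H_A /eqP shape_H]].
  rewrite inE (hat_array_composition VW _ p_la c_alpha size_la head_la sort_alpha).
  move=> F_A ->; split=> //; apply/eqP; apply: array_shape_unique => // n i.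
  by rewrite tnth_hat_array hat_rank_ltn.
have [|F eq_F] := @hat_array_surj k l m r H alpha size_alpha le_m.
  by move=> n i; rewrite (ltn_array_shape _ _ H_A) shape_H.
exists F; rewrite ?inE //.
by rewrite (hat_array_composition VW _ p_la c_alpha size_la head_la sort_alpha) eq_F.
Qed.

(** Exchange the sums: each composition array has exactly one shape, and this shape is a
    rearrangement of [la]. *)
Lemma sum_tableaux :
  \sum_(alpha <- compositions (sumn la) | sort_parts alpha == la)
    \sum_(F : filling k l alpha | composition_tableau V F) weight F =
  \sum_(H : array | composition_array W la H) array_weight rank_var H.
Proof.
transitivity (\sum_(alpha <- compositions (sumn la) | sort_parts alpha == la)
    \sum_(H : array | composition_array W la H)
       if array_shape H == alpha then array_weight rank_var H else 0).
  rewrite big_seq_cond [RHS]big_seq_cond; apply: eq_bigr => alpha.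
  rewrite mem_compositions => /andP[/andP[c_alpha _] /eqP sort_alpha].
  by rewrite sum_tableaux_shape // big_mkcondr.
rewrite exchange_big; apply: eq_bigr => H H_A; rewrite -big_mkcondr /=.
have sort_H := sort_array_shape p_la size_la head_la H_A.
rewrite (eq_bigl (pred1 (array_shape H))) => [|alpha]; last first.
  rewrite /= [array_shape H == _]eq_sym; case: (alpha =P _) => [->|]; rewrite ?andbF //.
  by rewrite sort_H eqxx.
have in_H : array_shape H \in compositions (sumn la).
  rewrite mem_compositions (array_shape_composition p_la size_la head_la H_A) /=.
  by rewrite -[in sumn la]sort_H (perm_sumn (s2 := array_shape H)) // perm_sort.
rewrite -big_filter (@perm_big _ _ _ _ _ [:: array_shape H]) ?big_seq1 //.
by rewrite filter_pred1_uniq // uniq_compositions.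
Qed.

End GeneratingFunctions.

Local Open Scope ring_scope.

Theorem theorem3p3 (k l : nat) (la : seq nat) (hla : is_partition la) :
  \sum_(alpha <- compositions (sumn la) | sort_parts alpha == la)
     HQ k l alpha =
  \sum_(beta <- compositions (sumn (conj_part la))
          | sort_parts beta == conj_part la)
     RHQ k l beta.
Proof.
(* Unprimed letters are those of rank below [k]. *)
pose W x := (x < k)%N.
have unprimedW (a : letter k l) : unprimed a = W (rank (Some a)).
  by case: a => [i|j]; rewrite /W /= ?ltn_ord // ltnNge leq_addr.
have primedW (a : letter k l) : primed a = predC W (rank (Some a)).
  by rewrite /primed unprimedW.
rewrite (sum_tableaux unprimedW hla erefl erefl) sum_composition_array.
rewrite (sum_young_array_conj _ _ hla erefl erefl) -sum_composition_array.
rewrite -(sum_tableaux primedW (conj_part_partition hla)) //.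
  exact: size_conj_part.
exact: head_conj_part.
Qed.
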